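(* Let $\{\pi_t\}_{t=1}^T$ be the (random) policy sequence generated by the algorithm SubMAPL in the open multi-agent Markov decision process described in the context. Assume: (1) for every $t\in[T]$ and every state $s\in\mathcal S$, the set function $F_t(\cdot;s):2^{\Omega_t}\to\mathbb R_{\ge 0}$ is normalized, monotone and submodular, and $\mathcal A_i\neq\emptyset$ for all $i\in\mathcal N_t$; (2) there is a constant $B<\infty$ such that $0\le F_t(e\mid A;s)\le B$ for all $t\in[T]$, all $s\in\mathcal S$, all $A\subseteq\Omega_t$ and all $e\in\Omega_t\setminus A$. Then, for any constant step size $\eta>0$, the open-system dynamic $1/2$-approximation regret $$\mathrm{Reg}_T^{1/2}=\sum_{t=1}^T\mathbb E_{\tau\sim p^{\widehat\pi}}\Big[\tfrac12F_t^\star(s_t)-\tilde f_t(x_t;s_t)\Big]$$ satisfies $$\mathrm{Reg}_T^{1/2}\ \le\ \frac{\mathbb E_{s_1\sim\mu_1}\big[D_{\mathrm{KL},1}(\pi_1^\star\Vert\pi_1)\big]+\mathcal V_T^{\mathrm{open}}}{2\eta}+\frac{\eta\,T\,N_{\max}B^2}{4}.$$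
   Context: Open multi-agent MDP. $T\in\mathbb N$, $[T]=\{1,\dots,T\}$. $(\mathcal N_t)_{t\in[T]}$ is an exogenously given sequence of finite sets of active agents (not influenced by the policies or the state transitions), $\mathcal N_0=\emptyset$, $N_{\max}=\max_{t}|\mathcal N_t|$. Each agent $i$ has a finite action set $\mathcal A_i$ and a finite observation space $\mathcal O_i$. $\mathcal S$ is the state space, $\mu_1$ the initial distribution on $\mathcal S$, $O_{i,t}:\mathcal S\to\mathcal O_i$ deterministic observation maps with $o_{i,t}=O_{i,t}(s_t)$, and $P_t(\cdot\mid s,\mathbf a)$ transition kernels, $s_{t+1}\sim P_t(\cdot\mid s_t,\mathbf a_t)$, $\mathbf a_t=(a_{i,t})_{i\in\mathcal N_t}$. (All functions of the state are assumed measurable where needed.) Put $\Omega_t=\{(i,a):i\in\mathcal N_t,a\in\mathcal A_i\}$, $\Omega_{i,t}=\{(i,a):a\in\mathcal A_i\}$, $\mathcal I_t=\{A\subseteq\Omega_t:|A\cap\Omega_{i,t}|\le1\ \forall i\in\mathcal N_t\}$. The executed set is $A_t=\{(i,a_{i,t}):i\in\mathcal N_t\}\in\mathcal I_t$. $F_t(\cdot;s):2^{\Omega_t}\to\mathbb R_{\ge0}$ is the stage utility, with marginal gain $F_t(e\mid A;s)=F_t(A\cup\{e\};s)-F_t(A;s)$. A set function $F$ is normalized if $F(\emptyset)=0$, monotone if $A\subseteq A'\Rightarrow F(A)\le F(A')$, submodular if $F(e\mid A)\ge F(e\mid A')$ for $A\subseteq A'$, $e\notin A'$. $[z]_+=\max\{z,0\}$.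 SubMAPL (step size $\eta$). Each active agent $i$ keeps logits $\theta^i(o,a)\in\mathbb R$, $o\in\mathcal O_i$, $a\in\mathcal A_i$; its policy is $\pi^i(a\mid o)=e^{\theta^i(o,a)}/\sum_{b\in\mathcal A_i}e^{\theta^i(o,b)}$. Initially (agents in $\mathcal N_1$) the logits are given finite values $\theta^{i,0}$. At time $t$, with current policy $\pi_t$ (local policies $\pi^i$, $i\in\mathcal N_t$): every $i\in\mathcal N_t$ observes $o_{i,t}$ and independently samples $a_{i,t}\sim\pi^i(\cdot\mid o_{i,t})$; set $A_t^{-i}=A_t\setminus\{(i,a_{i,t})\}$ and $\widehat g_{i,a,t}=F_t((i,a)\mid A_t^{-i};s_t)$ for all $a\in\mathcal A_i$; the logits are updated by $\theta^{i,+}(o_{i,t},a)=\theta^i(o_{i,t},a)+\eta\widehat g_{i,a,t}$, all other entries unchanged, giving the post-update policy $\pi_t^+$ (local policies $\pi^{i,+}$); then $s_{t+1}\sim P_t(\cdot\mid s_t,\mathbf a_t)$. Migration: $\pi_{t+1}$ has local policies $\pi^{i,+}$ for $i\in\mathcal N_{t+1}\cap\mathcal N_t$ and $\pi^{i,0}$ (softmax of given finite logits $\theta^{i,0}$) for $i\in\mathcal N_{t+1}\setminus\mathcal N_t$; departing agents are dropped. $\widehat\pi=\{\pi_t\}_{t=1}^T$ and $p^{\widehat\pi}$ is the law of the process so generated, with trajectory $\tau=(s_1,\mathbf a_1,\dots,s_T,\mathbf a_T,s_{T+1})$. $x_t\in[0,1]^{\Omega_t}$ is the vector with coordinates $x_{(i,a),t}=\pi^i(a\mid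 o_{i,t})$ for the local policies of $\pi_t$. Stagewise comparator. $\mathcal F_t=\{x\in[0,1]^{\Omega_t}:\sum_{a\in\mathcal A_i}x_{(i,a)}=1\ \forall i\in\mathcal N_t\}$. For $x\in\mathcal F_t$, $\tilde f_t(x;s)=\mathbb E[F_t(A;s)]$ where $A$ contains exactly one element of each $\Omega_{i,t}$, equal to $(i,a)$ with probability $x_{(i,a)}$, independently over $i\in\mathcal N_t$. $F_t^\star(s)=\max_{A\in\mathcal I_t}F_t(A;s)$. $x_t^\star\in\arg\max_{x\in\mathcal F_t}\tilde f_t(x;s_t)$ is a (measurable) selection determined by $t$ and $s_t$. $\pi_t^\star$ is the tabular policy with $(\pi_t^\star)^i(a\mid o_{i,t})=x^\star_{(i,a),t}$ and $(\pi_t^\star)^i(\cdot\mid o)=\pi^i(\cdot\mid o)$ (the local policy of $\pi_t$) for $o\ne o_{i,t}$. KL quantities. $D_{\mathrm{KL}}(p\Vert q)=\sum_a p_a\log(p_a/q_a)$ with $0\log(0/q)=0$; for tabular policies $\pi,\pi'$ on $\mathcal N_t$, $D_{\mathrm{KL},t}(\pi\Vert\pi')=\sum_{i\in\mathcal N_t}\sum_{o\in\mathcal O_i}D_{\mathrm{KL}}(\pi^i(\cdot\mid o)\Vert\pi'^i(\cdot\mid o))$. The open-system KL tracking variation is $$\mathcal V_T^{\mathrm{open}}=\mathbb E_{\tau\sim p^{\widehat\pi}}\Big[\sum_{t=1}^{T-1}\big[D_{\mathrm{KL},t+1}(\pi_{t+1}^\star\Vert\pi_{t+1})-D_{\mathrm{KL},t}(\pi_t^\star\Vert\pi_t^+)\big]_+\Big].$$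 *)

(* Defs.v *)
(* MathComp / MathComp-Analysis *)
From HB Require Import structures.
From mathcomp Require Import all_boot all_order all_algebra finmap.
From mathcomp Require Import all_classical all_reals all_analysis.

Set Implicit Arguments.
Unset Strict Implicit.
Unset Printing Implicit Defensive.

Import Order.TTheory GRing.Theory Num.Theory.
Import numFieldNormedType.Exports.

Local Open Scope classical_set_scope.
Local Open Scope ring_scope.

(* Stages are numbered from 0: stage t of {1, ..., T} is index t - 1 here, so
   s_1, ..., s_(T+1) are the states of index 0, ..., T.  Sequences are indexed
   by all of nat; entries beyond the horizon are filler and contribute to none of
   the quantities below. *)

Section SetFunctions.
Variables (R : realType) (E : finType).
Implicit Types (F : {set E} -> R) (A B : {set E}) (e : E).

Definition marginal F e A : R := F (e |: A)%SET - F A.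

Definition set_normalized F := F finset.set0 = 0.

Definition set_monotone F := forall A B, A \subset B -> F A <= F B.

Definition set_submodular F := forall A B e,
  A \subset B -> e \notin B -> marginal F e B <= marginal F e A.

End SetFunctions.

Section Distributions.
Variables (R : realType) (X : finType).

Definition softmax (theta : X -> R) (a : X) : R :=
  expR (theta a) / \sum_b expR (theta b).

(* The summand vanishes when p a = 0.  The value +oo for q a = 0 < p a is not
   represented: q is always a softmax, hence positive, in what follows. *)
Definition KL (p q : X -> R) : R := \sum_a p a * ln (p a / q a).

End Distributions.

Section Actions.
Variables (R : realType) (I : choiceType) (A : I -> finType) (N : {fset I}).

Definition joint_action : finType := {dffun forall i : N, A (val i)}.

(* the ground set {(i, a) : i in N, a in A i} *)
Definition ground : finType := {i : N & A (val i)}.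

Definition pt (i : N) (a : A (val i)) : ground :=
  Tagged (fun j : N => A (val j)) a.

Definition block (i : N) : {set ground} := [set e | tag e == i]%SET.

Definition independent (B : {set ground}) : bool :=
  [forall i : N, #|B :&: block i|%SET <= 1]%N.

Definition executed (a : joint_action) : {set ground} :=
  [set pt (a i) | i : N]%SET.

Definition executed_without (a : joint_action) (i : N) : {set ground} :=
  (executed a :\ pt (a i))%SET.

Definition feasible (x : ground -> R) : Prop :=
  (forall e, 0 <= x e <= 1) /\
  (forall i : N, \sum_(a : A (val i)) x (pt a) = 1).

Definition product_prob (x : ground -> R) (a : joint_action) : R :=
  \prod_(i : N) x (pt (a i)).

Definition categorical_extension (F : {set ground} -> R) (x : ground -> R) : R :=
  \sum_(a : joint_action) product_prob x a * F (executed a).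

(* The default value of the maximum is harmless: the empty set is independent. *)
Definition best (F : {set ground} -> R) : R :=
  \big[Num.max/F finset.set0]_(B : {set ground} | independent B) F B.

End Actions.

Record open_mdp (R : realType) (I : choiceType) (A O : I -> finType)
    (d : measure_display) (S : measurableType d) := OpenMDP {
  active : nat -> {fset I};
  obs : forall t (i : active t), S -> O (val i);
  init : probability S R;
  trans : forall t, joint_action A (active t) -> R.-pker S ~> S;
  utility : forall t, S -> {set ground A (active t)} -> R;
  measurable_obs : forall t (i : active t) (o : O (val i)),
    measurable [set s : S | obs i s = o];
  measurable_utility : forall t (B : {set ground A (active t)}),
    measurable_fun [set: S] (fun s => @utility t s B)
}.
Arguments active {R I A O d S}.
Arguments obs {R I A O d S}.
Arguments init {R I A O d S}.
Arguments trans {R I A O d S}.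
Arguments utility {R I A O d S}.

Section SubMAPL.
Variables (R : realType) (I : choiceType) (A O : I -> finType).
Variables (d : measure_display) (S : measurableType d).
Variable M : open_mdp R A O S.

(* logits or probabilities, indexed by agent, observation and action *)
Definition table t := forall i : active M t, O (val i) -> A (val i) -> R.

Definition policy t (theta : table t) : table t :=
  fun i o => softmax (theta i o).

Definition action_probs t (pi : table t) (s : S) :
    ground A (active M t) -> R :=
  fun e => pi (tag e) (obs M t (tag e) s) (tagged e).

Definition gain t (s : S) (a : joint_action A (active M t))
    (i : active M t) (b : A (val i)) : R :=
  marginal (utility M t s) (pt b) (executed_without a i).

Record trajectory := Trajectory {
  state : nat -> S;
  action : forall t, joint_action A (active M t)
}.

Variables (eta : R) (theta0 : forall i : I, O i -> A i -> R).

Definition update t (theta : table t) (s : S)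
    (a : joint_action A (active M t)) : table t :=
  fun i o b =>
    if o == obs M t i s then theta i o b + eta * gain s a b else theta i o b.

Definition migrate t (theta : table t) : table t.+1 :=
  fun i =>
    if @idP (val i \in active M t) is ReflectT active_i then theta [` active_i]%fset
    else @theta0 (val i).

Definition initial_logits : table 0 := fun i => @theta0 (val i).

Fixpoint logits (tau : trajectory) t : table t :=
  if t is u.+1 then migrate (update (@logits tau u) (state tau u) (action tau u))
  else initial_logits.
Arguments logits : clear implicits.

Definition current_policy (tau : trajectory) t : table t :=
  policy (logits tau t).
Arguments current_policy : clear implicits.

Definition updated_policy (tau : trajectory) t : table t :=
  policy (update (logits tau t) (state tau t) (action tau t)).
Arguments updated_policy : clear implicits.

Section Law.
Variables (T : nat) (d' : measure_display) (W : measurableType d').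
Variables (P : probability W R) (tau : W -> trajectory).

(* the sigma-algebra generated by s_0, a_0, ..., s_(t-1), a_(t-1), s_t *)
Definition history t : set (set W) :=
  <<s [set H | (exists k (U : set S), [/\ (k <= t)%N, measurable U &
                   H = (fun w => state (tau w) k) @^-1` U])
             \/ (exists k (a : joint_action A (active M k)),
                   (k < t)%N /\ H = [set w | action (tau w) k = a])] >>.

(* tau is distributed as the trajectory of SubMAPL over T stages.  As there are
   finitely many joint actions, conditioning on the history and on a_t amounts
   to conditioning on the history on each event a_t = a. *)
Record submapl_process : Prop := SubmaplProcess {
  measurable_state : forall t, (t <= T)%N ->
    measurable_fun [set: W] (fun w => state (tau w) t);
  measurable_action : forall t (a : joint_action A (active M t)), (t < T)%N ->
    measurable [set w | action (tau w) t = a];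
  law_init : forall U : set S, measurable U ->
    P ((fun w => state (tau w) 0) @^-1` U) = init M U;
  law_action : forall t (a : joint_action A (active M t)) (H : set W),
    (t < T)%N -> history t H ->
    P (H `&` [set w | action (tau w) t = a]) =
    (\int[P]_(w in H) (product_prob
       (action_probs (current_policy (tau w) t) (state (tau w) t)) a)%:E)%E;
  law_trans : forall t (a : joint_action A (active M t)) (H : set W) (U : set S),
    (t < T)%N -> history t H -> measurable U ->
    P (H `&` [set w | action (tau w) t = a]
         `&` (fun w => state (tau w) t.+1) @^-1` U) =
    (\int[P]_(w in H `&` [set w | action (tau w) t = a])
       trans M t a (state (tau w) t) U)%E
}.

End Law.

Definition KL_policy t (pi pi' : table t) : R :=
  \sum_(i : active M t) \sum_(o : O (val i)) KL (pi i o) (pi' i o).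

Variable xstar : forall t, S -> ground A (active M t) -> R.

Definition comparator_policy t (pi : table t) (s : S) : table t :=
  fun i o b => if o == obs M t i s then xstar s (pt b) else pi i o b.

Definition comparator (tau : trajectory) t : table t :=
  comparator_policy (current_policy tau t) (state tau t).
Arguments comparator : clear implicits.

Definition Nmax (T : nat) : nat := \max_(t < T) #|` active M t|.

Definition initial_KL : \bar R :=
  ('E_(init M) [fun s => KL_policy
     (comparator_policy (policy initial_logits) s) (policy initial_logits)])%E.

Section Quantities.
Variables (T : nat) (d' : measure_display) (W : measurableType d').
Variables (P : probability W R) (tau : W -> trajectory).

Definition regret : \bar R :=
  (\sum_(t < T) 'E_P [fun w =>
     let s := state (tau w) t in
     (1 / 2 * best (utility M t s)
      - categorical_extension (utility M t s)
          (action_probs (current_policy (tau w) t) s))%R])%E.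

Definition tracking_variation : \bar R :=
  ('E_P [fun w => (\sum_(t < T.-1)
     Num.max
       (KL_policy (comparator (tau w) t.+1) (current_policy (tau w) t.+1)
        - KL_policy (comparator (tau w) t) (updated_policy (tau w) t)) 0)%R])%E.

End Quantities.

End SubMAPL.

Arguments logits {R I A O d S M} eta theta0 tau t.
Arguments current_policy {R I A O d S M} eta theta0 tau t.
Arguments updated_policy {R I A O d S M} eta theta0 tau t.
Arguments comparator {R I A O d S M} eta theta0 xstar tau t.

(* Main.v *)
Require Import Defs.
From HB Require Import structures.
From mathcomp Require Import all_boot all_order all_algebra finmap.
From mathcomp Require Import all_classical all_reals all_analysis.
From mathcomp Require Import ring lra measurable_realfun.

Set Implicit Arguments.
Unset Strict Implicit.
Unset Printing Implicit Defensive.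

Import Order.TTheory GRing.Theory Num.Theory.
Import numFieldNormedType.Exports.

Local Open Scope classical_set_scope.
Local Open Scope ring_scope.

(* Per stage, the realized gains of agent i are an unbiased feedback vector for
   the marginal gains against the other agents' policies, and the logit update
   is exponential weights on them.  With D the KL divergence from the stage
   comparator, before and after the update, and <., .> the pairing over agents
   and actions,
     eta <x* - x, gain> <= D - D^+ + |N_t| (eta B)^2 / 2,
   the last term by Hoeffding's argument (symmetrization and
   cosh z <= exp (z^2 / 2)).  Conditionally on the history, submodularity gives
   E <x*, gain> >= f(x* ) - f(x) (add the actions of an independent comparator
   sample one at a time to the executed set) and E <x, gain> <= f(x), while
   f(x* ) >= F^*.  Summing over the stages, the divergences telescope up to the
   tracking variation. *)

(** * Joint actions and submodularity *)

(** Dependent functions are reindexed by [fprod], that is by tag-respecting plain functions into the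
    disjoint union, where a product of sums expands by [bigA_distr_big_dep]. *)
Lemma sum_prod_dffun (R : comPzSemiRingType) (J : finType) (X : J -> finType)
    (F : forall j, X j -> R) :
  \sum_(a : {dffun forall j, X j}) \prod_j F j (a j) = \prod_j \sum_b F j b.
Proof.
rewrite (reindex (@dffun_of_fprod J X)); last exact/onW_bij/dffun_of_fprod_bij.
pose P j : {ffun X j -> R} := [ffun b => F j b].
transitivity (\sum_(f : fprod X) \prod_(j in J) P j (f j)).
  by apply: eq_bigr => f _; apply: eq_bigr => j _; rewrite !ffunE.
rewrite big_fprod.
transitivity (\prod_j \sum_(g in tagged_with X j) untag 0 (P j) g).
  by rewrite bigA_distr_big_dep; apply: eq_bigl => f.
apply: eq_bigr => j _; rewrite -(big_tag (fun j => P j)).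
by apply: eq_bigr => b _; rewrite ffunE.
Qed.

Section Combinatorics.
Variables (R : realType) (I : choiceType) (A : I -> finType) (N : {fset I}).
Implicit Types (a : joint_action A N) (i j : N) (e : ground A N).
Implicit Types (x : ground A N -> R).

Lemma mem_executed a e : (e \in executed a) = (tagged e == a (tag e)).
Proof.
apply/imsetP/eqP => [[i _ ->]//|]; case: e => i b /= ->.
by exists i.
Qed.

Lemma mem_executed_without a i e :
  (e \in executed_without a i) = (tag e != i) && (tagged e == a (tag e)).
Proof.
rewrite in_setD1 mem_executed; case: (altP (tagged e =P a (tag e))) => /= [ea|_].
  rewrite !andbT; congr (~~ _); apply/eqP/eqP => [->//|]; case: e ea => j b /=.
  by move=> -> ->.
by rewrite !andbF.
Qed.

Lemma pt_notin_executed_without a i (b : A (val i)) :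
  pt b \notin executed_without a i.
Proof. by rewrite mem_executed_without eqxx. Qed.

Lemma executed_without_sub a i : executed_without a i \subset executed a.
Proof. by rewrite subD1set. Qed.

Definition deviate a i (b : A (val i)) : joint_action A N :=
  [ffun j => @eqtype.dfwith N (fun j => A (val j)) a i b j].

Lemma deviate_in a i (b : A (val i)) : deviate a b i = b.
Proof. by rewrite ffunE eqtype.dfwith_in. Qed.

Lemma deviate_out a i (b : A (val i)) j : i != j -> deviate a b j = a j.
Proof. by move=> ij; rewrite ffunE eqtype.dfwith_out. Qed.

Lemma deviateK a i (b : A (val i)) : deviate (deviate a b) (a i) = a.
Proof.
apply/ffunP => j; have [<-|ij] := eqVneq i j; first by rewrite deviate_in.
by rewrite !deviate_out.
Qed.

Lemma executed_without_deviate a i (b : A (val i)) :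
  executed_without (deviate a b) i = executed_without a i.
Proof.
apply/setP => e; rewrite !mem_executed_without.
have [//|ne] := eqVneq (tag e) i; first by rewrite deviate_out // eq_sym.
Qed.

(** Exchanging the action of agent [i] with [b] keeps the joint weight. The product form avoids
    dividing by [x (pt (a i))], which may vanish. *)
Lemma product_prob_deviate x a i (b : A (val i)) :
  product_prob x (deviate a b) * x (pt (a i)) = product_prob x a * x (pt b).
Proof.
rewrite /product_prob (bigD1 i) //= [in RHS](bigD1 i) //= deviate_in.
rewrite (eq_bigr (fun j => x (pt (a j)))) => [|j ji]; last first.
  by rewrite deviate_out // eq_sym.
by rewrite mulrAC [RHS]mulrC mulrA mulrAC [x (pt b) * _ * _]mulrAC.
Qed.

(** Redrawing the action of agent [i] independently does not change the product law: swapping [a i]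
    with the fresh draw [b] is a weight-preserving involution of the pairs [(a, b)]. *)
Lemma resample x i (h : joint_action A N -> R) :
  \sum_(b : A (val i)) x (pt b) = 1 ->
  \sum_a product_prob x a * \sum_(b : A (val i)) x (pt b) * h (deviate a b) =
  \sum_a product_prob x a * h a.
Proof.
move=> x1.
have -> : \sum_a product_prob x a * h a =
    \sum_(p : joint_action A N * A (val i))
      product_prob x p.1 * x (pt p.2) * h p.1.
  rewrite -(pair_bigA _ (fun a b => product_prob x a * x (pt b) * h a)) /=.
  apply: eq_bigr => a _; rewrite -[LHS]mulr1 -x1 mulr_sumr.
  by apply: eq_bigr => b _; rewrite mulrAC.
under eq_bigr do rewrite mulr_sumr.
rewrite (pair_bigA _ (fun a (b : A (val i)) =>
  product_prob x a * (x (pt b) * h (deviate a b)))) /=.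
pose f (p : joint_action A N * A (val i)) := (deviate p.1 p.2, p.1 i).
have fK : involutive f by case=> a b; rewrite /f /= deviateK deviate_in.
rewrite [RHS](reindex_inj (inv_inj fK)); apply: eq_bigr => -[a b] _ /=.
by rewrite product_prob_deviate mulrA.
Qed.

Lemma product_prob_ge0 x a : feasible x -> 0 <= product_prob x a.
Proof.
by move=> [x01 _]; apply: prodr_ge0 => i _; have /andP[] := x01 (pt (a i)).
Qed.

Lemma product_prob_sum1 x : feasible x -> \sum_a product_prob x a = 1.
Proof.
move=> [_ x1]; rewrite (sum_prod_dffun (fun i (b : A (val i)) => x (pt b))).
by rewrite big1.
Qed.

Lemma product_prob_marginal x i (h : A (val i) -> R) : feasible x ->
  \sum_a product_prob x a * h (a i) = \sum_b x (pt b) * h b.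
Proof.
move=> xf; have [_ x1] := xf.
rewrite -(resample (fun a => h (a i)) (x1 i)).
under eq_bigr do under eq_bigr do rewrite deviate_in.
by rewrite -mulr_suml product_prob_sum1 // mul1r.
Qed.

Section Utility.
Variable F : {set ground A N} -> R.
Hypotheses (F0 : set_normalized F) (Fmono : set_monotone F).
Hypothesis Fsub : set_submodular F.

Let gap i a (b : A (val i)) : R := marginal F (pt b) (executed_without a i).

(** Build the executed set one agent at a time from the empty set. Each increment is taken over a
    subset of the other agents' actions, so by submodularity it is at least the gap over all of
    them, and the increments telescope. *)
Lemma sum_gap_own a : \sum_i gap a (a i) <= F (executed a).
Proof.
suff H (r : seq N) : uniq r ->
    \sum_(i <- r) gap a (a i) <= F [set pt (a i) | i in r]%SET.
  apply: le_trans (H (index_enum N) (index_enum_uniq _)) _.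
  by apply: Fmono; apply/fintype.subsetP => e /imsetP[i _ ->]; apply: imset_f.
elim: r => [|i r IH] /=; first by rewrite big_nil (_ : imset _ _ = finset.set0)
  ?F0 //; apply/setP => e; rewrite inE; apply/imsetP => -[].
move=> /andP[ir ur]; rewrite big_cons.
have -> : [set pt (a j) | j in i :: r]%SET =
    (pt (a i) |: [set pt (a j) | j in r])%SET.
  apply/setP => e; rewrite in_setU1; apply/imsetP/orP.
    move=> [j]; rewrite inE => /orP[/eqP-> ->|jr ->]; first by left.
    by right; apply: imset_f.
  move=> [/eqP->|/imsetP[j jr ->]]; first by exists i; rewrite ?inE ?eqxx.
  by exists j; rewrite ?inE ?jr ?orbT.
set C := imset _ _ in IH *.
rewrite -[leRHS](subrK (F C)); apply: lerD; last exact: IH.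
apply: Fsub; last exact: pt_notin_executed_without.
apply/fintype.subsetP => e /imsetP[j jr ->].
rewrite mem_executed_without /= eqxx andbT.
by apply: contraNneq ir => <-.
Qed.

(** Add the actions of [a'] one at a time to [executed a]. Each increment is over a set containing
    [executed_without a i], so submodularity bounds it by the gap. *)
Lemma sum_gap_other a a' : F (executed a') - F (executed a) <= \sum_i gap a (a' i).
Proof.
suff H (r : seq N) :
    F (executed a :|: [set pt (a' i) | i in r])%SET - F (executed a)
      <= \sum_(i <- r) gap a (a' i).
  apply: le_trans (H (index_enum N)); rewrite lerD2r; apply: Fmono.
  apply/fintype.subsetP => e /imsetP[i _ ->]; rewrite inE; apply/orP; right.
  by apply: imset_f; rewrite mem_index_enum.
elim: r => [|i r IH] /=.
  rewrite big_nil (_ : imset _ _ = finset.set0) ?finset.setU0 ?subrr //.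
  by apply/setP => e; rewrite inE; apply/imsetP => -[].
rewrite big_cons; set C := (executed a :|: [set pt (a' j) | j in r])%SET in IH.
have -> : (executed a :|: [set pt (a' j) | j in i :: r])%SET = (pt (a' i) |: C)%SET.
  apply/setP => e; rewrite !inE orbCA; congr (_ || _); apply/imsetP/orP.
    move=> [j]; rewrite inE => /orP[/eqP-> ->|jr ->]; first by left.
    by right; apply: imset_f.
  move=> [/eqP->|/imsetP[j jr ->]]; first by exists i; rewrite ?inE ?eqxx.
  by exists j; rewrite ?inE ?jr ?orbT.
rewrite -(subrK (F C) (F (pt (a' i) |: C)%SET)) -addrA; apply: lerD => //.
(* Submodularity only speaks of elements outside the larger set. An element already in [C] adds
   nothing, and its gap is nonnegative by monotonicity. *)
have [eC|eC] := boolP (pt (a' i) \in C).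
  rewrite (_ : (_ |: C)%SET = C) ?subrr ?subr_ge0; last first.
    by apply/finset.setUidPr; rewrite finset.sub1set.
  by apply: Fmono; rewrite finset.subsetU1.
apply: Fsub => //.
by rewrite (fintype.subset_trans (executed_without_sub a i)) // finset.subsetUl.
Qed.

(** Against [y] the pairing is an average of [sum_gap_other] over an independent [a'] drawn from
    [y]; against [x] it is, by resampling, an average of [sum_gap_own]. Each costs one copy of the
    extension at [x], whence the factor 2. *)
Lemma expected_gap (x y : ground A N -> R) : feasible x -> feasible y ->
  categorical_extension F y - 2 * categorical_extension F x <=
  \sum_a product_prob x a *
    \sum_i \sum_(b : A (val i)) (y (pt b) - x (pt b)) * gap a b.
Proof.
move=> xf yf.
have -> : \sum_a product_prob x a *
      \sum_i \sum_(b : A (val i)) (y (pt b) - x (pt b)) * gap a b =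
    \sum_a product_prob x a * (\sum_a' product_prob y a' * \sum_i gap a (a' i))
    - \sum_a product_prob x a * \sum_i gap a (a i).
  (* The gap of agent [i] ignores [a i], so the realized action may stand for a fresh draw from
     [x]. *)
  have -> : \sum_a product_prob x a * \sum_i gap a (a i) =
      \sum_a product_prob x a * \sum_i \sum_(b : A (val i)) x (pt b) * gap a b.
    under eq_bigr do rewrite mulr_sumr; rewrite exchange_big /=.
    under [RHS]eq_bigr do rewrite mulr_sumr; rewrite [RHS]exchange_big /=.
    apply: eq_bigr => i _; have [_ x1] := xf.
    rewrite -(resample (fun a => gap a (a i)) (x1 i)); apply: eq_bigr => a _.
    congr (_ * _); apply: eq_bigr => b _.
    by rewrite deviate_in /gap executed_without_deviate.
  rewrite -sumrB; apply: eq_bigr => a _; rewrite -mulrBr; congr (_ * _).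
  (* Each summand reads a single coordinate of [a'], so only the marginals of [y] enter. *)
  have -> : \sum_a' product_prob y a' * \sum_i gap a (a' i) =
      \sum_i \sum_(b : A (val i)) y (pt b) * gap a b.
    under eq_bigr do rewrite mulr_sumr; rewrite exchange_big /=.
    by apply: eq_bigr => i _; rewrite (product_prob_marginal _ yf).
  rewrite -sumrB; apply: eq_bigr => i _; rewrite -sumrB; apply: eq_bigr => b _.
  by rewrite mulrBl.
have -> : categorical_extension F y - 2 * categorical_extension F x =
    \sum_a product_prob x a * (categorical_extension F y - F (executed a))
    - \sum_a product_prob x a * F (executed a).
  under eq_bigr do rewrite mulrBr; rewrite sumrB -mulr_suml product_prob_sum1 //.
  by rewrite mul1r /categorical_extension mulr_natl mulr2n opprD addrA.
apply: lerB; apply: ler_sum => a _; apply: ler_wpM2l;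
  rewrite ?product_prob_ge0 ?sum_gap_own //.
have -> : categorical_extension F y - F (executed a) =
    \sum_a' product_prob y a' * (F (executed a') - F (executed a)).
  under [RHS]eq_bigr do rewrite mulrBr; rewrite sumrB -mulr_suml.
  by rewrite product_prob_sum1 // mul1r.
by apply: ler_sum => a' _; rewrite ler_wpM2l ?product_prob_ge0 ?sum_gap_other.
Qed.

Lemma best_ge0 : (forall C, 0 <= F C) -> 0 <= best F.
Proof. by move=> F_ge0; rewrite /best bigmax_idl le_max F_ge0. Qed.

(** An optimal [y] dominates every point mass, hence every executed set. As the action sets are
    nonempty, any independent set extends to an executed one, and monotonicity concludes. *)
Lemma best_le_categorical (y : ground A N -> R) :
  (forall i, (0 < #|A (val i)|)%N) ->
  (forall x, feasible x -> categorical_extension F x <= categorical_extension F y) ->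
  best F <= categorical_extension F y.
Proof.
move=> A0 ymax.
(* The feasible point is the indicator of [executed a]; every other joint action then has product
   probability zero. *)
have vertex a : F (executed a) <= categorical_extension F y.
  pose x e : R := (e \in executed a)%:R.
  have xf : feasible x.
    split=> [e|i]; first by rewrite /x; case: (_ \in _); rewrite ?lexx ler01.
    rewrite (bigD1 (a i)) //= big1 => [|b ba]; rewrite /x mem_executed /=.
      by rewrite eqxx addr0.
    by rewrite (negbTE ba).
  apply: le_trans (ymax _ xf); rewrite /categorical_extension (bigD1 a) //= big1.
    rewrite addr0 /product_prob big1 ?mul1r // => i _.
    by rewrite /x mem_executed eqxx.
  move=> a' aa'; suff -> : product_prob x a' = 0 by rewrite mul0r.
  apply/eqP/prodf_eq0; case: (boolP [exists i, a' i != a i]) => [/existsP[i ne]|].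
    by exists i => //; rewrite /x mem_executed /= (negbTE ne).
  rewrite negb_exists => /forallP eqa; case/eqP: aa'; apply/ffunP => i.
  by apply/eqP; rewrite -[_ == _]negbK eqa.
have extend (C : {set ground A N}) : independent C -> exists a, C \subset executed a.
  move=> /forallP indep.
  (* Each agent plays its element of [C] if it has one and an arbitrary action otherwise;
     independence makes the picked element the only one in its block. *)
  pose a : joint_action A N := [ffun i =>
    odflt (enum_val (Ordinal (A0 i))) [pick b : A (val i) | pt b \in C]].
  exists a; apply/fintype.subsetP => -[i b] /[dup] bC ptC; rewrite mem_executed /= ffunE.
  case: pickP => [b' b'C|/(_ b)]; last by rewrite bC.
  have := indep i; rewrite (cardsD1 (pt b)) (cardsD1 (pt b')) !inE.
  rewrite -[existT _ _ _]/(pt b) in ptC; rewrite ptC b'C /= !eqxx /=.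
  have [e _|] := eqVneq (pt b') (pt b) => //.
  by apply/eqP/esym; move/eqP: e; rewrite eq_Tagged => /eqP.
(* The default [F finset.set0] of the maximum must be bounded too, which takes one joint action. *)
have [a0 _] : exists a : joint_action A N, finset.set0 \subset executed a.
  by exists [ffun i => enum_val (Ordinal (A0 i))]; rewrite finset.sub0set.
rewrite /best; apply/bigmax_leP; split.
  by apply: le_trans (vertex a0); apply: Fmono; rewrite finset.sub0set.
by move=> C /extend[a /Fmono Ca]; exact: le_trans (vertex a).
Qed.

End Utility.

End Combinatorics.

(** * Exponential weights *)

Section Exponential.
Variable R : realType.
Implicit Types z : R.

(** After multiplication by [expR (- (z ^+ 2 / 2))] the left-hand side is [h z], and the claim
    becomes [h z <= h 0]. On the nonnegative half-line the derivative of [h] has the sign of [k],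
    which starts at 0 and does not increase. *)
Lemma expRD_expRN_le z : expR z + expR (- z) <= 2 * expR (z ^+ 2 / 2).
Proof.
wlog z0 : z / 0 <= z.
  move=> H; have [/H//|/ltW z0] := leP 0 z.
  by have := H (- z); rewrite sqrrN opprK addrC oppr_ge0; apply.
pose k z : R := (1 - z) * expR z - (1 + z) * expR (- z).
pose h z : R := expR (- (z ^+ 2 / 2)) * (expR z + expR (- z)).
have dk (x : R) : is_derive x 1 k (- x * (expR x - expR (- x))).
  rewrite /k; apply: is_derive_eq; rewrite /GRing.scale /=; ring.
have dh (x : R) : is_derive x 1 h (expR (- (x ^+ 2 / 2)) * k x).
  rewrite /h /k; apply: is_derive_eq; rewrite /GRing.scale /=; by field.
have cont (f : R -> R) : (forall x : R, derivable f x 1) ->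
    {within `[0, +oo[%classic, continuous f}.
  move=> df; apply: continuous_subspaceT => y.
  by apply/differentiable_continuous/derivable1_diffP.
have k0 x : 0 <= x -> k x <= 0.
  move=> x0; have -> : 0 = k 0 by rewrite /k oppr0 addr0 subrr.
  apply: (@ler0_derive1_nincry _ k 0) => //; last by apply: cont.
  move=> y; rewrite in_itv /= andbT => y0.
  rewrite derive1E (@derive_val _ _ _ _ _ _ _ (dk y)).
  rewrite mulNr oppr_le0 mulr_ge0 ?(ltW y0) // subr_ge0 ler_expR; lra.
have : h z <= h 0.
  apply: (@ler0_derive1_nincry _ h 0) => //; last by apply: cont.
  move=> y; rewrite in_itv /= andbT => y0.
  rewrite derive1E (@derive_val _ _ _ _ _ _ _ (dh y)).
  by apply: mulr_ge0_le0; [exact: expR_ge0|exact/k0/ltW].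
rewrite /h expr0n /= mul0r oppr0 !expR0 mul1r expRN mulrC.
by rewrite ler_pdivrMr ?expR_gt0.
Qed.

End Exponential.

Section Softmax.
Variables (R : realType) (X : finType).
Implicit Types p q g theta : X -> R.

Lemma sum_expR_gt0 theta (a : X) : 0 < \sum_b expR (theta b).
Proof.
rewrite (bigD1 a) //= ltr_pwDl ?expR_gt0 //; apply: sumr_ge0 => b _.
exact: expR_ge0.
Qed.

Lemma softmax_gt0 theta a : 0 < softmax theta a.
Proof. by rewrite divr_gt0 ?expR_gt0 ?(sum_expR_gt0 _ a). Qed.

Lemma sum_softmax theta : (0 < #|X|)%N -> \sum_a softmax theta a = 1.
Proof.
move=> /card_gt0P[a _]; rewrite /softmax -mulr_suml divff //.
by rewrite gt_eqF ?(sum_expR_gt0 _ a).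
Qed.

(** Gibbs' inequality: [ln u <= u - 1] at [u = q a / p a] makes each summand at least [p a - q a],
    and these differences sum to zero. The case [p a = 0] is immediate. *)
Lemma KL_ge0 p q : (forall a, 0 <= p a) -> (forall a, 0 < q a) ->
  \sum_a p a = 1 -> \sum_a q a = 1 -> 0 <= KL p q.
Proof.
move=> p0 q0 p1 q1; rewrite -(subrr 1) -[X in X - _]p1 -q1 -sumrB.
apply: ler_sum => a _; have := p0 a; rewrite le_eqVlt => /orP[/eqP<-|pa].
  by rewrite mul0r sub0r oppr_le0 ltW.
have /le_ln1Dx : -1 < q a / p a - 1 by rewrite ltrBrDr addNr divr_gt0.
rewrite addrC subrK => le_ln.
rewrite -[p a / q a]invf_div lnV ?posrE ?divr_gt0 // mulrN -lerN2 opprK opprB.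
apply: le_trans (ler_wpM2l (ltW pa) le_ln) _.
by rewrite mulrBr mulr1 mulrC divfK ?gt_eqF.
Qed.

(* Symmetrization: by Jensen, exp (- E g) <= E exp (- g), and the product of the
   two moments is E cosh (g - g') for an independent copy g' of g. *)
Lemma exp_moment_le q g (c : R) : (forall a, 0 <= q a) -> \sum_a q a = 1 ->
  (forall a, 0 <= g a <= c) ->
  \sum_a q a * expR (g a) <= expR (\sum_a q a * g a + c ^+ 2 / 2).
Proof.
move=> q0 q1 gc; set m := \sum_a q a * g a.
have jensen : expR (- m) <= \sum_a q a * expR (- g a).
  (* The tangent line of the exponential at [- m]; its linear part [m - g a] has mean zero. *)
  have -> : expR (- m) = \sum_a q a * (expR (- m) * (1 + (m - g a))).
    transitivity (expR (- m) * \sum_a (q a + (q a * m - q a * g a))).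
      by rewrite big_split sumrB /= -mulr_suml q1 mul1r -/m subrr addr0 mulr1.
    by rewrite mulr_sumr; apply: eq_bigr => a _; ring.
  apply: ler_sum => a _; apply: ler_wpM2l => //.
  rewrite (_ : expR (- g a) = expR (- m) * expR (m - g a)).
    by rewrite ler_wpM2l ?expR_ge0 ?expR_ge1Dx.
  by rewrite -expRD addKr.
rewrite expRD -ler_pdivrMl ?expR_gt0 // -expRN.
have S0 : 0 <= \sum_a q a * expR (g a).
  by apply: sumr_ge0 => a _; rewrite mulr_ge0 ?expR_ge0.
apply: le_trans (ler_wpM2r S0 jensen) _.
pose D a b : R := q a * q b * expR (g b - g a).
have -> : (\sum_a q a * expR (- g a)) * (\sum_a q a * expR (g a)) =
    \sum_a \sum_b D a b.
  rewrite big_distrlr /=; apply: eq_bigr => a _; apply: eq_bigr => b _.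
  by rewrite /D expRD; ring.
(* Doubling pairs [(a, b)] with [(b, a)], which produces twice the hyperbolic cosine of [g b - g a],
   a number between [- c] and [c]. *)
suff : 2 * (\sum_a \sum_b D a b) <= 2 * expR (c ^+ 2 / 2) by rewrite ler_pM2l.
rewrite mulr2n mulrDl mul1r [X in _ + X]exchange_big -big_split /=.
have -> : (1 + 1) * expR (c ^+ 2 / 2) =
    \sum_a \sum_b q a * q b * (2 * expR (c ^+ 2 / 2)).
  under eq_bigr do rewrite -mulr_suml -mulr_sumr q1 mulr1.
  by rewrite -mulr_suml q1; ring.
apply: ler_sum => a _; rewrite -big_split /=; apply: ler_sum => b _.
have -> : D a b + D b a =
    q a * q b * (expR (g b - g a) + expR (- (g b - g a))).
  by rewrite /D opprB; ring.
apply: ler_wpM2l; first by rewrite mulr_ge0.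
apply: le_trans (expRD_expRN_le _) _; rewrite ler_pM2l // ler_expR.
rewrite ler_pM2r ?invr_gt0 // !expr2.
by have /andP[? ?] := gc a; have /andP[? ?] := gc b; nra.
Qed.

(** The new softmax is the old one reweighted by [expR (g a) / Z], so the drop in divergence is
    exactly [\sum_a p a * g a - ln Z]. The moment bound controls [ln Z] by the mean of [g] under the
    old softmax plus [c ^+ 2 / 2]. *)
Lemma KL_softmax_descent p theta g (c : R) :
  (forall a, 0 <= p a) -> \sum_a p a = 1 -> (forall a, 0 <= g a <= c) ->
  \sum_a (p a - softmax theta a) * g a <=
  KL p (softmax theta) - KL p (softmax (fun a => theta a + g a)) + c ^+ 2 / 2.
Proof.
move=> p0 p1 gc; set q := softmax theta; set q' := softmax _.
have X0 : (0 < #|X|)%N.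
  rewrite lt0n; apply/eqP => X0; move/eqP: p1.
  by rewrite big1 ?(eq_sym 0) ?oner_eq0 // => a; have := fintype0 a.
have [a0 _] := card_gt0P X0.
have q_gt0 a : 0 < q a by exact: softmax_gt0.
pose Z := \sum_a q a * expR (g a).
have Z0 : 0 < Z.
  rewrite /Z (bigD1 a0) //= ltr_pwDl ?(mulr_gt0 (q_gt0 _)) ?expR_gt0 //.
  by apply: sumr_ge0 => a _; rewrite mulr_ge0 ?expR_ge0 // ltW.
have q'E a : q' a = q a * (expR (g a) / Z).
  rewrite /q' /q /Z /softmax expRD.
  have -> : \sum_b expR (theta b) / (\sum_b0 expR (theta b0)) * expR (g b) =
      (\sum_b expR (theta b + g b)) / (\sum_b expR (theta b)).
    by rewrite mulr_suml; apply: eq_bigr => b _; rewrite expRD mulrAC.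
  by field; apply/andP; split; rewrite gt_eqF //; exact: (sum_expR_gt0 _ a0).
have -> : KL p q - KL p q' = \sum_a p a * g a - ln Z.
  rewrite -[ln Z]mul1r -p1 mulr_suml -!sumrB; apply: eq_bigr => a _.
  have := p0 a; rewrite le_eqVlt => /orP[/eqP<-|pa]; first by rewrite !mul0r.
  rewrite q'E; move: (q a) (q_gt0 a) => r r0.
  have eZ : 0 < expR (g a) / Z by rewrite divr_gt0 ?expR_gt0.
  rewrite !ln_div ?posrE ?(mulr_gt0 r0 eZ) // lnM ?posrE //.
  by rewrite ln_div ?posrE ?expR_gt0 // expRK; ring.
under eq_bigr do rewrite mulrBl; rewrite sumrB -addrA lerD2l -lerNl opprD opprK.
rewrite lerBlDr -[leRHS]expRK ler_ln ?posrE ?expR_gt0 //.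
by apply: exp_moment_le => // [a|]; [rewrite ltW|exact: sum_softmax].
Qed.

End Softmax.

(** * Measurability and conditioning *)

Section Measurability.
Context d (T : measurableType d) (R : realType).

(** Split along the finitely many fibres of [alpha] with indicators. This serves quantities
    evaluated at a random joint action or a random observation. *)
Lemma measurable_fun_finite (X : finType) (alpha : T -> X) (h : X -> T -> R) :
  (forall x, measurable [set w | alpha w = x]) ->
  (forall x, measurable_fun [set: T] (h x)) ->
  measurable_fun [set: T] (fun w => h (alpha w) w).
Proof.
move=> malpha mh.
rewrite (_ : (fun w => _) =
    (fun w => \sum_x \1_[set w | alpha w = x] w * h x w)).
  by apply: measurable_sum => x; apply: measurable_funM.
apply/funext => w; rewrite (bigD1 (alpha w)) //= indicE mem_set //= mul1r.
rewrite big1 ?addr0 // => x xne; rewrite indicE memNset ?mul0r //=.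
by move=> eqx; rewrite eqx eqxx in xne.
Qed.

Lemma measurable_fun_bigmax (J : Type) (r : seq J) (Q : pred J) (f0 : T -> R)
    (f : J -> T -> R) :
  measurable_fun [set: T] f0 -> (forall j, measurable_fun [set: T] (f j)) ->
  measurable_fun [set: T] (fun w => \big[Num.max/f0 w]_(j <- r | Q j) f j w).
Proof.
move=> mf0 mf; elim: r => [|j r IH].
  by under eq_fun do rewrite big_nil.
under eq_fun do rewrite big_cons; case: (Q j) => //; exact: measurable_maxr.
Qed.

(** On nonnegative reals the inverse is the power -1, also at 0, where both vanish. *)
Lemma measurable_fun_inv (f : T -> R) : (forall w, 0 <= f w) ->
  measurable_fun [set: T] f -> measurable_fun [set: T] (fun w => (f w)^-1).
Proof.
move=> f0 mf; under eq_fun do rewrite -powR_inv1 //.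
exact: (measurableT_comp (measurable_powR (-1)) mf).
Qed.

Lemma measurable_fun_softmax (X : finType) (theta : T -> X -> R) (a : X) :
  (forall b, measurable_fun [set: T] (fun w => theta w b)) ->
  measurable_fun [set: T] (fun w => softmax (theta w) a).
Proof.
move=> mtheta; apply: measurable_funM; first exact: measurableT_comp.
apply: measurable_fun_inv => [w|]; first by apply: sumr_ge0 => b _; exact: expR_ge0.
by apply: measurable_sum => b; exact: measurableT_comp.
Qed.

Lemma measurable_fun_KL (X : finType) (p q : T -> X -> R) :
  (forall w a, 0 <= q w a) ->
  (forall a, measurable_fun [set: T] (fun w => p w a)) ->
  (forall a, measurable_fun [set: T] (fun w => q w a)) ->
  measurable_fun [set: T] (fun w => KL (p w) (q w)).
Proof.
move=> q0 mp mq; apply: measurable_sum => a; apply: measurable_funM => //.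
apply: measurableT_comp => //; apply: measurable_funM => //.
exact: measurable_fun_inv.
Qed.

End Measurability.

(** * Integration against a conditional probability given a sub-sigma-algebra *)

Section Conditioning.
Context d (W : measurableType d) (R : realType) (P : probability W R).
Variable G : set (set W).
Hypothesis G_measurable : forall H, <<s G>> H -> measurable H.
Let WG := g_sigma_algebraType G.

Lemma measurable_fun_coarse d' (Y : measurableType d') (f : W -> Y) :
  measurable_fun [set: WG] f -> measurable_fun [set: W] f.
Proof. by move=> mf _ U mU; apply: G_measurable; exact: mf. Qed.

Import HBNNSimple.

(** [p] acts as the conditional probability of [E] given [<<s G>>]. The hypothesis is the case of
    indicators of sets in [<<s G>>]; linearity extends it to simple functions and monotone
    convergence to nonnegative [f]. *)
Lemma integral_conditional_density (E : set W) (p f : W -> R) :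
  measurable E -> measurable_fun [set: W] p -> (forall w, 0 <= p w) ->
  (forall H, <<s G>> H -> P (H `&` E) = \int[P]_(w in H) (p w)%:E)%E ->
  measurable_fun [set: WG] f -> (forall w, 0 <= f w) ->
  (\int[P]_(w in E) (f w)%:E = \int[P]_w (f w * p w)%:E)%E.
Proof.
move=> mE mp p0 Ep mf f0.
have mef : measurable_fun [set: WG] (EFin \o f) by exact/measurable_EFinP.
pose f_ : nat -> {nnsfun WG >-> R} := nnsfun_approx measurableT mef.
have mf_ n : measurable_fun [set: W] (f_ n : W -> R).
  exact/measurable_fun_coarse/measurable_funP.
have nd w m n : (m <= n)%N -> f_ m w <= f_ n w.
  by move=> mn; exact/lefP/(nd_nnsfun_approx measurableT mef mn).
have cvgf w : EFin \o f_ ^~ w @ \oo --> (f w)%:E.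
  by apply: (cvg_nnsfun_approx measurableT mef) => // x _; rewrite /= lee_fin.
transitivity (limn (fun n => \int[P]_(w in E) (f_ n w)%:E))%E.
  rewrite -monotone_convergence //.
  - by apply: eq_integral => w _; apply/esym/cvg_lim => //; exact: cvgf.
  - by move=> n; apply/measurable_EFinP/measurable_funTS.
  - by move=> n w _; rewrite lee_fin.
  - by move=> w _ m n mn; rewrite lee_fin; exact: nd.
rewrite [X in limn X](_ : _ = (fun n => \int[P]_w (f_ n w * p w)%:E)%E).
  rewrite -monotone_convergence //.
  - apply: eq_integral => w _; apply/cvg_lim => //; rewrite EFinM.
    under eq_fun do rewrite EFinM.
    by apply: cvgeZr => //; exact: cvgf.
  - by move=> n; apply/measurable_EFinP/measurable_funM.
  - by move=> n w _; rewrite lee_fin mulr_ge0.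
  - by move=> w _ m n mn; rewrite lee_fin ler_wpM2r // nd.
apply/funext => n.
have mfib k : <<s G>> (f_ n @^-1` [set k]).
  by rewrite -[_ @^-1` _]setTI; exact: (measurable_funP (f_ n)).
(* Decompose [f_ n] over its level sets, which belong to [<<s G>>]. *)
transitivity (\sum_(k \in range (f_ n))
    \int[P]_(w in E) (k * \1_(f_ n @^-1` [set k]) w)%:E)%E.
  under eq_integral do rewrite fimfunE -fsumEFin //.
  rewrite ge0_integral_fsum //.
  - move=> k; apply/measurable_EFinP/measurable_funTS/measurable_funM => //.
    exact/measurable_indic/G_measurable.
  - by move=> k w _; rewrite nnfun_muleindic_ge0.
transitivity (\sum_(k \in range (f_ n))
    \int[P]_w (k * \1_(f_ n @^-1` [set k]) w * p w)%:E)%E; last first.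
  rewrite -ge0_integral_fsum //.
  - apply: eq_integral => w _; rewrite fsumEFin //; congr (_%:E).
    by rewrite [in RHS]fimfunE mulr_fsuml.
  - move=> k; apply/measurable_EFinP/measurable_funM => //; apply: measurable_funM => //.
    exact/measurable_indic/G_measurable.
  - by move=> k w _; rewrite EFinM mule_ge0 ?nnfun_muleindic_ge0 ?lee_fin.
apply: eq_fsbigr => k; rewrite inE => -[w0 _ fk].
have k0 : 0 <= k by rewrite -fk.
have mH := G_measurable (mfib k); set H := _ @^-1` _ in mH *.
under eq_integral do rewrite EFinM.
rewrite ge0_integralZl //; last first.
  by apply/measurable_EFinP/measurable_funTS/measurable_indic.
under [RHS]eq_integral do rewrite -mulrA EFinM.
rewrite ge0_integralZl //; first last.
- by move=> w _; rewrite lee_fin mulr_ge0.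
- by apply/measurable_EFinP/measurable_funM => //; exact: measurable_indic.
congr (_ * _)%E; rewrite integral_indic //.
apply: etrans (Ep H (mfib k)) _; rewrite [LHS]integral_mkcond; apply: eq_integral => w _.
rewrite patchE indicE; case: ifPn => wH; first by rewrite mul1r.
by rewrite mul0r.
Qed.

(** The tower property for a finite-valued [alpha]: on each event [alpha = x] the integrand is the
    coarsely measurable [f x], so the event can be replaced by its conditional probability. *)
Lemma integral_conditional_finite (X : finType) (alpha : W -> X)
    (p : X -> W -> R) (f : X -> W -> R) :
  (forall x, measurable [set w | alpha w = x]) ->
  (forall x, measurable_fun [set: W] (p x)) -> (forall x w, 0 <= p x w) ->
  (forall x H, <<s G>> H ->
     P (H `&` [set w | alpha w = x]) = \int[P]_(w in H) (p x w)%:E)%E ->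
  (forall x, measurable_fun [set: WG] (f x)) -> (forall x w, 0 <= f x w) ->
  (\int[P]_w (f (alpha w) w)%:E = \int[P]_w (\sum_x p x w * f x w)%:E)%E.
Proof.
move=> malpha mp p0 Hp mf f0.
have mf' x := measurable_fun_coarse (mf x).
transitivity (\sum_x \int[P]_(w in [set w | alpha w = x]) (f x w)%:E)%E.
  under [RHS]eq_bigr do rewrite integral_mkcond.
  rewrite -ge0_integral_sum //.
  - apply: eq_integral => w _; rewrite (bigD1 (alpha w)) //= patchE mem_set //=.
    rewrite big1 ?adde0 // => x xne; rewrite patchE memNset //=.
    by move=> eqx; rewrite eqx eqxx in xne.
  - move=> x; apply/(measurable_restrictT _ (malpha x)).
    exact/measurable_EFinP/measurable_funTS.
  - by move=> x w _; rewrite patchE; case: ifP => // _; rewrite lee_fin.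
under [RHS]eq_integral do rewrite -sumEFin.
rewrite ge0_integral_sum //.
- apply: eq_bigr => x _.
  rewrite (integral_conditional_density (malpha x) (mp x) (p0 x) (Hp x)) //.
  by apply: eq_integral => w _; rewrite mulrC.
- by move=> x; apply/measurable_EFinP/measurable_funM.
- by move=> x w _; rewrite lee_fin mulr_ge0.
Qed.

End Conditioning.

(** * One stage of the algorithm *)

Section Descent.
Variables (R : realType) (I : choiceType) (A O : I -> finType).
Variables (d : measure_display) (S : measurableType d).
Variable M : open_mdp R A O S.
Variables (eta : R) (theta0 : forall i : I, O i -> A i -> R).

(** * Measurability along a trajectory, for the full sigma-algebra and for a history alike *)

Section MeasurableTrajectory.
Context d' (W : measurableType d') (tau : W -> trajectory M) (n : nat).
Hypothesis mstate : forall k, (k <= n)%N ->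
  measurable_fun [set: W] (fun w => state (tau w) k).
Hypothesis maction : forall k (a : joint_action A (active M k)), (k < n)%N ->
  measurable [set w | action (tau w) k = a].

Lemma measurable_obs_state k (i : active M k) (o : O (val i)) : (k <= n)%N ->
  measurable [set w | obs M k i (state (tau w) k) = o].
Proof.
move=> kn; rewrite -[[set _ | _]]setTI.
exact: (mstate kn measurableT (measurable_obs o)).
Qed.

Lemma measurable_utility_state k (C : {set ground A (active M k)}) : (k <= n)%N ->
  measurable_fun [set: W] (fun w => utility M k (state (tau w) k) C).
Proof.
move=> kn; exact: (measurableT_comp (measurable_utility C) (mstate kn)).
Qed.

Lemma measurable_gain k (a : joint_action A (active M k)) (i : active M k)
    (b : A (val i)) : (k <= n)%N ->
  measurable_fun [set: W] (fun w => gain (state (tau w) k) a b).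
Proof. by move=> kn; apply: measurable_funB; exact: measurable_utility_state. Qed.

(** Freezing first the joint action, then the observation, both finite-valued, leaves a
    deterministic test in the update. *)
Lemma measurable_update k (theta : W -> table M k) : (k < n)%N ->
  (forall (i : active M k) (o : O (val i)) (b : A (val i)),
     measurable_fun [set: W] (fun w => theta w i o b)) ->
  forall (i : active M k) (o : O (val i)) (b : A (val i)),
     measurable_fun [set: W]
    (fun w => update eta (theta w) (state (tau w) k) (action (tau w) k) o b : R).
Proof.
move=> kn mtheta i o b; have kn' := ltnW kn.
apply: (measurable_fun_finite (h := fun a w =>
  update eta (theta w) (state (tau w) k) a o b)) => a; first exact: maction.
apply: (measurable_fun_finite (h := fun o1 w =>
  if o == o1 then theta w i o b + eta * gain (state (tau w) k) a b
  else theta w i o b)) => o1; first exact: measurable_obs_state.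
case: (o == o1) => //; apply: measurable_funD => //.
by apply: measurable_funM => //; exact: measurable_gain.
Qed.

Lemma measurable_logits k : (k <= n)%N ->
  forall (i : active M k) (o : O (val i)) (b : A (val i)),
  measurable_fun [set: W] (fun w => logits eta theta0 (tau w) k i o b).
Proof.
elim: k => [_ i o b|k IH kn i o b] /=; first exact: measurable_cst.
(* Membership in the previous active set is exogenous, hence the same for all [w]. *)
rewrite /migrate; case: {-}_ / idP => [act|_]; last exact: measurable_cst.
by apply: measurable_update => // ? ? ?; apply: IH; exact: ltnW.
Qed.

Lemma measurable_current_policy k : (k <= n)%N ->
  forall (i : active M k) (o : O (val i)) (b : A (val i)),
  measurable_fun [set: W] (fun w => current_policy eta theta0 (tau w) k i o b).
Proof.
by move=> kn i o b; apply: measurable_fun_softmax => b'; exact: measurable_logits.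
Qed.

Lemma measurable_updated_policy k : (k < n)%N ->
  forall (i : active M k) (o : O (val i)) (b : A (val i)),
  measurable_fun [set: W] (fun w => updated_policy eta theta0 (tau w) k i o b).
Proof.
move=> kn i o b; apply: measurable_fun_softmax => b'.
by apply: measurable_update => // *; exact/measurable_logits/ltnW.
Qed.

Lemma measurable_action_probs k e : (k <= n)%N ->
  measurable_fun [set: W] (fun w =>
    action_probs (current_policy eta theta0 (tau w) k) (state (tau w) k) e).
Proof.
move=> kn; apply: (measurable_fun_finite
  (h := fun o w => current_policy eta theta0 (tau w) k (tag e) o (tagged e))).
  by move=> o; exact: measurable_obs_state.
by move=> o; exact: measurable_current_policy.
Qed.

Lemma measurable_product_prob k (a : joint_action A (active M k)) : (k <= n)%N ->
  measurable_fun [set: W] (fun w => product_prob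
    (action_probs (current_policy eta theta0 (tau w) k) (state (tau w) k)) a).
Proof.
by move=> kn; apply: measurable_prod => i _; exact: measurable_action_probs.
Qed.

Lemma measurable_best k : (k <= n)%N ->
  measurable_fun [set: W] (fun w => best (utility M k (state (tau w) k))).
Proof.
move=> kn; apply: measurable_fun_bigmax; first exact: measurable_utility_state.
by move=> C; exact: measurable_utility_state.
Qed.

Lemma measurable_categorical k : (k <= n)%N ->
  measurable_fun [set: W] (fun w => categorical_extension
    (utility M k (state (tau w) k))
    (action_probs (current_policy eta theta0 (tau w) k) (state (tau w) k))).
Proof.
move=> kn; apply: measurable_sum => a; apply: measurable_funM.
  exact: measurable_product_prob.
exact: measurable_utility_state.
Qed.

Variable xstar : forall t, S -> ground A (active M t) -> R.

Lemma measurable_xstar_state k (e : ground A (active M k)) : (k <= n)%N ->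
  (forall e : ground A (active M k),
     measurable_fun [set: S] (fun s => @xstar k s e)) ->
  measurable_fun [set: W] (fun w => @xstar k (state (tau w) k) e).
Proof. by move=> kn mx; exact: (measurableT_comp (mx e) (mstate kn)). Qed.

Lemma measurable_comparator k : (k <= n)%N ->
  (forall e : ground A (active M k),
     measurable_fun [set: S] (fun s => @xstar k s e)) ->
  forall (i : active M k) (o : O (val i)) (b : A (val i)),
  measurable_fun [set: W] (fun w => comparator eta theta0 xstar (tau w) k i o b).
Proof.
move=> kn mx i o b; apply: (measurable_fun_finite (h := fun o1 w =>
  if o == o1 then @xstar k (state (tau w) k) (pt b)
  else current_policy eta theta0 (tau w) k i o b)) => o1.
  exact: measurable_obs_state.
by case: (o == o1); [exact: measurable_xstar_state|exact: measurable_current_policy].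
Qed.

Lemma measurable_KL_policy k (pi pi' : W -> table M k) :
  (forall w (i : active M k) (o : O (val i)) (b : A (val i)), 0 <= pi' w i o b) ->
  (forall (i : active M k) (o : O (val i)) (b : A (val i)),
     measurable_fun [set: W] (fun w => pi w i o b)) ->
  (forall (i : active M k) (o : O (val i)) (b : A (val i)),
     measurable_fun [set: W] (fun w => pi' w i o b)) ->
  measurable_fun [set: W] (fun w => KL_policy (pi w) (pi' w)).
Proof.
move=> pi'0 mpi mpi'; apply: measurable_sum => i; apply: measurable_sum => o.
exact: measurable_fun_KL.
Qed.

End MeasurableTrajectory.

Section Pointwise.
Variables (t : nat) (theta : table M t) (s : S) (a : joint_action A (active M t)).
Variable xstar : forall t, S -> ground A (active M t) -> R.
Hypothesis xstar_feasible : feasible (@xstar t s).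
Hypothesis A_nonempty : forall i : active M t, (0 < #|A (val i)|)%N.

Lemma feasible_action_probs : feasible (action_probs (policy theta) s).
Proof.
split=> [[i b]|i]; last exact: sum_softmax.
rewrite /action_probs /policy /= ltW ?softmax_gt0 //=.
rewrite -(sum_softmax (@theta i (obs M t i s)) (A_nonempty i)) (bigD1 b) //= lerDl.
by apply: sumr_ge0 => b' _; rewrite ltW ?softmax_gt0.
Qed.

(** At every observation both arguments are probability vectors, the second one positive. Leaving
    [theta'] free covers the initial policy and the updated one. *)
Lemma KL_comparator_ge0 (theta' : table M t) :
  0 <= KL_policy (comparator_policy xstar (policy theta) s) (policy theta').
Proof.
apply: sumr_ge0 => i _; apply: sumr_ge0 => o _; have [x01 x1] := xstar_feasible.
rewrite /comparator_policy; apply: KL_ge0 => [b|b||].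
- case: ifP => _; last by rewrite ltW ?softmax_gt0.
  by have /andP[] := x01 (pt b).
- exact: softmax_gt0.
- by case: (o == _); [exact: x1|exact: sum_softmax].
- exact: sum_softmax.
Qed.

(** Only the row of the observed [o] changes, and there the update is an exponential-weights step
    with gains [eta * gain s a b] between 0 and [eta * B]. Each active agent pays one error term. *)
Lemma KL_comparator_descent (B : R) : 0 < eta ->
  (forall (i : active M t) (b : A (val i)), 0 <= gain s a b <= B) ->
  eta * \sum_i \sum_(b : A (val i))
    (@xstar t s (pt b) - action_probs (policy theta) s (pt b)) * gain s a b <=
  KL_policy (comparator_policy xstar (policy theta) s) (policy theta)
  - KL_policy (comparator_policy xstar (policy theta) s)
      (policy (update eta theta s a))
  + #|` active M t|%:R * ((eta * B) ^+ 2 / 2).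
Proof.
move=> eta0 gB; rewrite /KL_policy -sumrB.
have -> : #|` active M t|%:R * ((eta * B) ^+ 2 / 2) =
    \sum_(i : active M t) ((eta * B) ^+ 2 / 2).
  by rewrite sumr_const -cardfE mulr_natl.
rewrite -big_split mulr_sumr /=; apply: ler_sum => i _.
set o := obs M t i s; have [x01 x1] := xstar_feasible.
rewrite -sumrB [X in _ <= X + _](bigD1 o) //=.
(* At other observations the comparator, current and updated policies coincide, so the divergences
   cancel. *)
rewrite [X in _ <= _ + X + _]big1 ?addr0 => [|o1 o1o]; last first.
  have -> : comparator_policy xstar (policy theta) s o1 = policy theta o1.
    by apply/funext => b; rewrite /comparator_policy (negbTE o1o).
  have -> : policy (update eta theta s a) o1 = policy theta o1.
    congr softmax; apply/funext => b.
    by rewrite /update (negbTE o1o).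
  by rewrite subrr.
have -> : comparator_policy xstar (policy theta) s o =
    (fun b => @xstar t s (pt b)).
  by apply/funext => b; rewrite /comparator_policy eqxx.
have -> : policy (update eta theta s a) o =
    softmax (fun b => @theta i o b + eta * gain s a b).
  by congr softmax; apply/funext => b; rewrite /update eqxx.
rewrite mulr_sumr; under eq_bigr do rewrite mulrCA.
apply: KL_softmax_descent => [b||b].
- by have /andP[] := x01 (pt b).
- exact: x1.
- by have /andP[g0 g1] := gB i b; rewrite mulr_ge0 ?(ltW eta0) //= ler_pM2l.
Qed.

End Pointwise.

End Descent.

(** * Regret *)

(** Build [C] up one element at a time. The absolute value of [B] keeps the bound monotone in the
    cardinality, so [#|C|] relaxes to [#|E|]. *)
Lemma set_function_bounded (R : realType) (E : finType) (F : {set E} -> R) (B : R)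
    (C : {set E}) :
  set_normalized F -> (forall (C : {set E}) e, e \notin C -> marginal F e C <= B) ->
  F C <= #|E|%:R * `|B|.
Proof.
move=> F0 FB; suff H n : forall C : {set E}, #|C| = n -> F C <= n%:R * `|B|.
  by apply: le_trans (H _ _ erefl) _; rewrite ler_wpM2r // ler_nat max_card.
elim: n => [|n IH] {}C cardC; first by rewrite (cards0_eq cardC) F0 mul0r.
have /card_gt0P[e eC] : (0 < #|C|)%N by rewrite cardC.
have cardCe : #|(C :\ e)%SET| = n by move: cardC; rewrite (cardsD1 e) eC => -[].
have := FB (C :\ e)%SET e; rewrite !inE eqxx /= => /(_ isT).
rewrite /marginal finset.setD1K // => /le_trans/(_ (ler_norm B)) le_gap.
by rewrite -(subrK (F (C :\ e)%SET) (F C)) -natr1 mulrDl mul1r addrC lerD // IH.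
Qed.

(** Each difference [u t.+1 - v t] is at most its positive part, and the last [v n] remains. *)
Lemma telescope_positive_part (R : realDomainType) (u v : nat -> R) (n : nat) :
  \sum_(t < n.+1) (u t - v t) <=
  u 0%N + \sum_(t < n) Num.max (u t.+1 - v t) 0 - v n.
Proof.
elim: n => [|n IH]; first by rewrite big_ord_recr !big_ord0 /= add0r addr0.
rewrite big_ord_recr /= [X in _ + X - _]big_ord_recr /=.
have : u n.+1 - v n <= Num.max (u n.+1 - v n) 0 by rewrite le_max lexx.
by move: IH; lra.
Qed.

(** * Integrals of real functions under a probability *)

Section Integration.
Context d (W : measurableType d) (R : realType) (P : probability W R).
Implicit Types f g : W -> R.

Lemma integrable_bounded f (K : R) : measurable_fun [set: W] f ->
  (forall w, `|f w| <= K) -> P.-integrable [set: W] (EFin \o f).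
Proof.
move=> mf fK; apply: measurable_bounded_integrable => //.
  by apply: (@le_lt_trans _ _ 1%E); [exact: probability_le1|exact: ltry].
by exists K; split => [|M KM w _ /=]; rewrite ?num_real // (le_trans (fK w)) ?ltW.
Qed.

(** If the upper integral is infinite there is nothing to prove; otherwise [g] is integrable and
    monotonicity applies. This admits an infinite tracking variation. *)
Lemma integral_le_nonneg f g : P.-integrable [set: W] (EFin \o f) ->
  measurable_fun [set: W] g -> (forall w, 0 <= g w) -> (forall w, f w <= g w) ->
  (\int[P]_w (f w)%:E <= \int[P]_w (g w)%:E)%E.
Proof.
move=> intf mg g0 fg.
have [goo|] := ltP (\int[P]_w (g w)%:E)%E +oo%E; last first.
  by rewrite leye_eq => /eqP ->; rewrite leey.
apply: le_integral => //; last by move=> w _; rewrite lee_fin.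
apply/integrableP; split; first exact/measurable_EFinP.
by under eq_integral do rewrite /= ger0_norm //.
Qed.

Lemma integral_nonnegD f g :
  measurable_fun [set: W] f -> measurable_fun [set: W] g ->
  (forall w, 0 <= f w) -> (forall w, 0 <= g w) ->
  (\int[P]_w (f w + g w)%:E = \int[P]_w (f w)%:E + \int[P]_w (g w)%:E)%E.
Proof.
move=> mf mg f0 g0; under eq_integral do rewrite EFinD.
apply: ge0_integralD => [|w _||w _|].
- exact: measurableT.
- by rewrite lee_fin.
- exact/measurable_EFinP.
- by rewrite lee_fin.
- exact/measurable_EFinP.
Qed.

Lemma integral_scale (k : R) f : P.-integrable [set: W] (EFin \o f) ->
  (\int[P]_w (k * f w)%:E = k%:E * \int[P]_w (f w)%:E)%E.
Proof.
move=> intf; under eq_integral do rewrite EFinM.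
exact: (integralZl measurableT intf).
Qed.

Lemma integrable_scale (k : R) f : P.-integrable [set: W] (EFin \o f) ->
  P.-integrable [set: W] (EFin \o (fun w => k * f w)).
Proof.
move=> intf; rewrite (_ : _ \o _ = fun w => (k%:E * (EFin \o f) w)%E) //.
exact: (integrableZl measurableT k intf).
Qed.

Lemma integral_sum_scale (n : nat) (k : R) (f : 'I_n -> W -> R) :
  (forall i, P.-integrable [set: W] (EFin \o f i)) ->
  P.-integrable [set: W] (EFin \o (fun w => \sum_(i < n) k * f i w)) /\
  (\int[P]_w (\sum_(i < n) k * f i w)%:E =
   \sum_(i < n) k%:E * \int[P]_w (f i w)%:E)%E.
Proof.
move=> intf; have intkf i := integrable_scale k (intf i); split.
  rewrite (_ : _ \o _ = fun w => (\sum_(i < n) (k * f i w)%:E)%E).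
    exact: (integrable_sum measurableT _ (fun i _ => intkf i)).
  by apply/funext => w /=; rewrite sumEFin.
under eq_integral do rewrite -sumEFin.
rewrite (integral_sum measurableT intkf); apply: eq_bigr => i _.
exact: integral_scale.
Qed.

(** A constant shift can make both functions nonnegative, which opens the way to results on
    nonnegative integrands; integrability lets the shift cancel afterwards. *)
Lemma integral_leD2r f g (C : R) : P.-integrable [set: W] (EFin \o f) ->
  P.-integrable [set: W] (EFin \o g) ->
  (\int[P]_w (f w + C)%:E <= \int[P]_w (g w + C)%:E)%E ->
  (\int[P]_w (f w)%:E <= \int[P]_w (g w)%:E)%E.
Proof.
move=> intf intg.
have intC : P.-integrable [set: W] (EFin \o cst C).
  exact: (@integrable_bounded _ `|C|).
have addC h : P.-integrable [set: W] (EFin \o h) ->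
    (\int[P]_w (h w + C)%:E = \int[P]_w (h w)%:E + C%:E)%E.
  move=> inth; under eq_integral do rewrite EFinD.
  rewrite integralD //; congr (_ + _)%E.
  by rewrite integral_cst //= probability_setT mule1.
by rewrite !addC // leeD2rE.
Qed.

End Integration.

Section Regret.
Variables (R : realType) (I : choiceType) (A O : I -> finType).
Variables (d : measure_display) (S : measurableType d) (M : open_mdp R A O S).
Variables (T : nat) (theta0 : forall i : I, O i -> A i -> R) (eta : R).
Variables (d' : measure_display) (W : measurableType d') (P : probability W R).
Variable tau : W -> trajectory M.
Hypothesis tau_law : submapl_process eta theta0 T P tau.

Section History.
Variable t : nat.
Hypothesis tT : (t < T)%N.

(** [history] is already a generated sigma-algebra, and [g_sigma_algebraType] generates once more;
    the two levels collapse. *)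
Lemma history_closed H : <<s history tau t >> H -> history tau t H.
Proof. by apply: smallest_sub => //; exact: smallest_sigma_algebra. Qed.

Lemma history_measurable H : <<s history tau t >> H -> measurable H.
Proof.
move=> /history_closed; apply: smallest_sub; first exact: sigma_algebra_measurable.
move=> _ [[k [U [kt mU ->]]]|[k [a [kt ->]]]].
  rewrite -[_ @^-1` _]setTI.
  exact: (measurable_state tau_law (leq_trans kt (ltnW tT))).
exact: (measurable_action tau_law a (ltn_trans kt tT)).
Qed.

Let WH := g_sigma_algebraType (history tau t).

Lemma measurable_state_history k : (k <= t)%N ->
  measurable_fun [set: WH] (fun w => state (tau w) k).
Proof.
move=> kt _ U mU; rewrite setTI; apply: sub_gen_smallest.
by apply: sub_gen_smallest; left; exists k, U.
Qed.

Lemma measurable_action_history k (a : joint_action A (active M k)) : (k < t)%N ->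
  measurable ([set w | action (tau w) k = a] : set WH).
Proof.
move=> kt; apply: sub_gen_smallest.
by apply: sub_gen_smallest; right; exists k, a.
Qed.

End History.

Variable xstar : forall t, S -> ground A (active M t) -> R.
Hypothesis xstar_measurable : forall t (e : ground A (active M t)), (t < T)%N ->
  measurable_fun [set: S] (fun s => @xstar t s e).
Hypothesis xstar_feasible : forall t (s : S), (t < T)%N -> feasible (@xstar t s).
Hypothesis xstar_optimal :
  forall t (s : S) (x : ground A (active M t) -> R), (t < T)%N -> feasible x ->
  categorical_extension (utility M t s) x <=
  categorical_extension (utility M t s) (@xstar t s).
Hypothesis A_nonempty :
  forall t (i : active M t), (t < T)%N -> (0 < #|A (val i)|)%N.
Hypothesis utility_ge0 : forall t (s : S) (C : {set ground A (active M t)}),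
  (t < T)%N -> 0 <= utility M t s C.
Hypothesis utility_normalized : forall t (s : S),
  (t < T)%N -> set_normalized (utility M t s).
Hypothesis utility_monotone : forall t (s : S),
  (t < T)%N -> set_monotone (utility M t s).
Hypothesis utility_submodular : forall t (s : S),
  (t < T)%N -> set_submodular (utility M t s).
Variable B : R.
Hypothesis marginal_bounded :
  forall t (s : S) (C : {set ground A (active M t)}) (e : ground A (active M t)),
  (t < T)%N -> e \notin C -> 0 <= marginal (utility M t s) e C <= B.

Let probs t w := action_probs (current_policy eta theta0 (tau w) t) (state (tau w) t).
Let F t w := utility M t (state (tau w) t).

(** The joint action is a free argument, so that for fixed [a] the advantage is a function of the
    history alone; the realized action is substituted afterwards. *)
Definition advantage t (a : joint_action A (active M t)) (w : W) : R :=
  \sum_i \sum_(b : A (val i))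
    (xstar (state (tau w) t) (pt b) - probs w (pt b)) * gain (state (tau w) t) a b.

Definition realized_advantage t (w : W) : R := advantage (action (tau w) t) w.

Section Stage.
Variable t : nat.
Hypothesis tT : (t < T)%N.

Lemma gain_bounded s (a : joint_action A (active M t)) (i : active M t)
  (b : A (val i)) : 0 <= gain s a b <= B.
Proof. exact: (marginal_bounded _ tT (pt_notin_executed_without a b)). Qed.

Lemma feasible_probs w : feasible (@probs t w).
Proof. by apply: feasible_action_probs => i; exact: A_nonempty. Qed.

Lemma advantage_bounded (a : joint_action A (active M t)) w :
  `|advantage a w| <= \sum_(i : active M t) \sum_(b : A (val i)) `|B|.
Proof.
apply: le_trans (ler_norm_sum _ _ _) _; apply: ler_sum => i _.
apply: le_trans (ler_norm_sum _ _ _) _; apply: ler_sum => b _.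
have [x01 _] := feasible_probs w.
have [y01 _] := xstar_feasible (state (tau w) t) tT.
have /andP[g0 gB] := gain_bounded (state (tau w) t) a b.
rewrite normrM -[leRHS]mul1r; apply: ler_pM => //.
  by rewrite ler_norml; have /andP[] := x01 (pt b); have /andP[] := y01 (pt b); lra.
by rewrite ger0_norm // (le_trans gB) // ler_norm.
Qed.

Let K : R := #|{: ground A (active M t)}|%:R * `|B|.

Lemma utility_bounded s C : utility M t s C <= K.
Proof.
apply: set_function_bounded; first exact: utility_normalized.
by move=> C' e /(marginal_bounded s tT) /andP[].
Qed.

Lemma best_bounds w : 0 <= best (@F t w) <= K.
Proof.
rewrite best_ge0 => [|C]; last exact: utility_ge0.
by apply/bigmax_leP; split => [|C _]; exact: utility_bounded.
Qed.

Lemma categorical_bounds w : 0 <= categorical_extension (@F t w) (@probs t w) <= K.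
Proof.
have fw := feasible_probs w; apply/andP; split.
  by apply: sumr_ge0 => a _; rewrite mulr_ge0 ?product_prob_ge0 // utility_ge0.
rewrite -[leRHS]mul1r -(product_prob_sum1 fw) mulr_suml; apply: ler_sum => a _.
by rewrite ler_wpM2l ?product_prob_ge0 // utility_bounded.
Qed.

(** With [a] fixed, only states up to [t] and actions before [t] occur, the latter through the
    logits. *)
Lemma measurable_advantage_history (a : joint_action A (active M t)) :
  measurable_fun [set: g_sigma_algebraType (history tau t)] (advantage a).
Proof.
have ms := @measurable_state_history t; have ma := @measurable_action_history t.
apply: measurable_sum => i; apply: measurable_sum => b; apply: measurable_funM.
  apply: measurable_funB.
    by apply: (measurable_xstar_state ms) => // e; exact: xstar_measurable.
  exact: (measurable_action_probs _ _ ms ma).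
exact: (measurable_gain ms).
Qed.

Lemma measurable_state_le k : (k <= t)%N ->
  measurable_fun [set: W] (fun w => state (tau w) k).
Proof.
by move=> kt; apply: (measurable_state tau_law); rewrite (leq_trans kt) // ltnW.
Qed.

Lemma measurable_action_le k (a : joint_action A (active M k)) : (k < t.+1)%N ->
  measurable [set w | action (tau w) k = a].
Proof.
by move=> kt; apply: (measurable_action tau_law); rewrite (leq_trans kt).
Qed.

Lemma measurable_realized_advantage :
  measurable_fun [set: W] (@realized_advantage t).
Proof.
apply: (measurable_fun_finite (h := @advantage t)) => a.
  exact: measurable_action_le.
exact: (measurable_fun_coarse (history_measurable tT) (measurable_advantage_history a)).
Qed.

Lemma integrable_realized_advantage :
  P.-integrable [set: W] (EFin \o @realized_advantage t).
Proof.
apply: (@integrable_bounded _ _ _ _ _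
  (\sum_(i : active M t) \sum_(b : A (val i)) `|B|)).
  exact: measurable_realized_advantage.
by move=> w; exact: advantage_bounded.
Qed.

Lemma measurable_stage :
  measurable_fun [set: W] (fun w => best (@F t w)) /\
  measurable_fun [set: W]
    (fun w => categorical_extension (@F t w) (@probs t w)).
Proof.
have ms := measurable_state_le.
have ma k (a : joint_action A (active M k)) (kt : (k < t)%N) :=
  measurable_action_le a (ltnW kt).
split; first exact: (measurable_best ms).
exact: (measurable_categorical _ _ ms ma).
Qed.

Lemma integrable_stage : P.-integrable [set: W] (EFin \o
  (fun w => best (@F t w) - 2 * categorical_extension (@F t w) (@probs t w))).
Proof.
have [mbest mcat] := measurable_stage.
apply: (@integrable_bounded _ _ _ P _ (2 * K)).
  by apply: measurable_funB => //; exact: measurable_funM.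
move=> w; rewrite ler_norml.
by have /andP[] := best_bounds w; have /andP[] := categorical_bounds w; lra.
Qed.

(** Conditioning on the history averages the realized action over the product law of the current
    policy. This average is bounded below pointwise by [expected_gap], combined with
    [best_le_categorical]. *)
Lemma expected_advantage :
  (\int[P]_w (best (@F t w) - 2 * categorical_extension (@F t w) (@probs t w))%:E
   <= \int[P]_w (realized_advantage t w)%:E)%E.
Proof.
have [mbest mcat] := measurable_stage.
have mX : measurable_fun [set: W]
    (fun w => best (@F t w) - 2 * categorical_extension (@F t w) (@probs t w)).
  by apply: measurable_funB => //; exact: measurable_funM.
(* Large enough to make both shifted integrands nonnegative: [2 * K] serves the stage quantity, the
   double sum serves the advantage. *)
pose C := 2 * K + \sum_(i : active M t) \sum_(b : A (val i)) `|B|.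
have K0 : 0 <= K by rewrite mulr_ge0.
have L0 : 0 <= \sum_(i : active M t) \sum_(b : A (val i)) `|B|.
  by apply: sumr_ge0 => i _; exact: sumr_ge0.
apply: (@integral_leD2r _ _ _ _ _ _ C).
- exact: integrable_stage.
- exact: integrable_realized_advantage.
have advC a w : 0 <= @advantage t a w + C.
  by have := advantage_bounded a w; rewrite ler_norml /C => /andP[]; lra.
rewrite (integral_conditional_finite (history_measurable tT)
  (alpha := fun w => action (tau w) t) (p := fun a w => product_prob (@probs t w) a)
  (f := fun a w => advantage a w + C)) //; first last.
- by move=> a; apply: measurable_funD => //; exact: measurable_advantage_history.
- by move=> a H /history_closed; exact: (law_action tau_law).
- by move=> a w; exact/product_prob_ge0/feasible_probs.
- move=> a; apply: (measurable_product_prob _ _ measurable_state_le) => // k a' kt.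
  exact/measurable_action_le/ltnW.
- by move=> a; exact: measurable_action_le.
apply: ge0_le_integral => //.
- move=> w _; rewrite lee_fin /C.
  by have /andP[] := best_bounds w; have /andP[] := categorical_bounds w; lra.
- by apply/measurable_EFinP/measurable_funD.
- apply/measurable_EFinP/measurable_sum => a; apply: measurable_funM.
    apply: (measurable_product_prob _ _ measurable_state_le) => // k a' kt.
    exact/measurable_action_le/ltnW.
  apply: measurable_funD => //.
  exact: (measurable_fun_coarse (history_measurable tT) (measurable_advantage_history a)).
- move=> w _; rewrite lee_fin; have fw := feasible_probs w.
  (* The product probabilities sum to one, so the shift [C] cancels. *)
  under eq_bigr do rewrite mulrDr; rewrite big_split /= -mulr_suml.
  rewrite (product_prob_sum1 fw) mul1r lerD2r.
  have := expected_gap (utility_normalized (state (tau w) t) tT)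
    (utility_monotone (state (tau w) t) tT) (utility_submodular (state (tau w) t) tT)
    fw (xstar_feasible (state (tau w) t) tT).
  apply: le_trans; rewrite lerD2r; apply: best_le_categorical.
  + exact: utility_monotone.
  + by move=> i; exact: A_nonempty.
  + by move=> x fx; exact: xstar_optimal.
Qed.

End Stage.

(** * Summation over the stages *)

Hypothesis eta_gt0 : 0 < eta.
Hypothesis T_gt0 : (0 < T)%N.

Let D t w := KL_policy (comparator eta theta0 xstar (tau w) t)
  (current_policy eta theta0 (tau w) t).
Let D' t w := KL_policy (comparator eta theta0 xstar (tau w) t)
  (updated_policy eta theta0 (tau w) t).
Let V w := \sum_(t < T.-1) Num.max (D t.+1 w - D' t w) 0.
Let c : R := T%:R * ((Nmax M T)%:R * ((eta * B) ^+ 2 / 2)).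

(** This is pathwise: the stage descents telescope up to the positive parts in [V], the last
    divergence is dropped by nonnegativity, and each active set has at most [Nmax M T] agents. *)
Lemma sum_realized_advantage_le w :
  \sum_(t < T) eta * realized_advantage t w <= D 0 w + V w + c.
Proof.
pose e t : R := #|` active M t|%:R * ((eta * B) ^+ 2 / 2).
have step t : (t < T)%N -> eta * realized_advantage t w <= D t w - D' t w + e t.
  move=> tT; apply: KL_comparator_descent => //.
  - exact: xstar_feasible.
  - by move=> i b; exact: gain_bounded.
have D'0 : 0 <= D' T.-1 w.
  apply: KL_comparator_ge0; first by apply: xstar_feasible; rewrite prednK.
  by move=> i; apply: A_nonempty; rewrite prednK.
have ec : \sum_(t < T) e t <= c.
  rewrite /c -[T in T%:R]card_ord mulr_natl -sumr_const; apply: ler_sum => t _.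
  rewrite ler_wpM2r ?divr_ge0 ?sqr_ge0 // ler_nat.
  exact: (@leq_bigmax _ (fun t : 'I_T => #|` active M t|)).
apply: (@le_trans _ _ (\sum_(t < T) (D t w - D' t w) + \sum_(t < T) e t)).
  by rewrite -big_split; apply: ler_sum => t _; exact: step.
(* Writing [T] as [T.-1.+1] matches the [T.-1] transitions between consecutive stages. *)
apply: lerD => //; rewrite -[in leLHS](prednK T_gt0).
apply: le_trans (telescope_positive_part (D ^~ w) (D' ^~ w) T.-1) _.
by rewrite gerBl.
Qed.

Lemma initial_KL_ge0 s :
  0 <= KL_policy (comparator_policy xstar
      (policy (@initial_logits _ _ _ O _ _ M theta0)) s)
    (policy (@initial_logits _ _ _ O _ _ M theta0)).
Proof.
apply: KL_comparator_ge0; first exact: xstar_feasible.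
by move=> i; exact: A_nonempty.
Qed.

(** At stage 0 the logits are deterministic, so the divergence is a function of the initial state,
    whose law under [P] is [init M]; the rest is a change of variables. *)
Lemma expectation_initial_KL :
  (\int[P]_w (D 0 w)%:E = initial_KL theta0 xstar)%E.
Proof.
pose L0 : table M 0 := @initial_logits _ _ _ O _ _ M theta0.
pose g s : R := KL_policy (comparator_policy xstar (policy L0) s) (policy L0).
have m0 : measurable_fun [set: W] (fun w => state (tau w) 0).
  exact: (measurable_state tau_law).
have mg : measurable_fun [set: S] g.
  apply: measurable_KL_policy => [s i o b|i o b|i o b].
  - by rewrite ltW // softmax_gt0.
  - apply: (measurable_fun_finite (h := fun o1 s =>
      if o == o1 then @xstar 0 s (pt b) else policy L0 o b)) => o1.
      exact: measurable_obs.
    by case: (o == o1); [exact: xstar_measurable|exact: measurable_cst].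
  - exact: measurable_cst.
rewrite /initial_KL unlock.
rewrite (eq_measure_integral (pushforward P (fun w => state (tau w) 0))); last first.
  by move=> U mU _; exact: (esym (law_init tau_law mU)).
rewrite ge0_integral_pushforward //.
- exact/measurable_EFinP.
- by move=> s _; rewrite lee_fin initial_KL_ge0.
Qed.

Lemma measurable_KL_current t : (t < T)%N -> measurable_fun [set: W] (D t).
Proof.
move=> tT; have ms := measurable_state_le tT.
have ma k (a : joint_action A (active M k)) (kt : (k < t)%N) :=
  measurable_action_le tT a (ltnW kt).
apply: measurable_KL_policy => [w i o b|i o b|i o b].
- by rewrite ltW // softmax_gt0.
- apply: (measurable_comparator _ _ ms ma) => // e; exact: xstar_measurable.
- exact: (measurable_current_policy _ _ ms ma).
Qed.

Lemma measurable_KL_updated t : (t < T)%N -> measurable_fun [set: W] (D' t).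
Proof.
move=> tT; have ms k (kt : (k <= t.+1)%N) :=
  measurable_state tau_law (leq_trans kt tT).
have ma k (a : joint_action A (active M k)) (kt : (k < t.+1)%N) :=
  measurable_action_le tT a kt.
apply: measurable_KL_policy => [w i o b|i o b|i o b].
- by rewrite ltW // softmax_gt0.
- apply: (measurable_comparator _ _ ms ma) => // e; exact: xstar_measurable.
- exact: (measurable_updated_policy _ _ ms ma).
Qed.

Lemma measurable_variation : measurable_fun [set: W] V.
Proof.
apply: measurable_sum => t; have tT : (t.+1 < T)%N by rewrite -ltn_predRL.
apply: measurable_maxr; last exact: measurable_cst.
by apply: measurable_funB; [exact: measurable_KL_current|exact/measurable_KL_updated/ltnW].
Qed.

Lemma expected_sum_realized_advantage :
  (\int[P]_w (\sum_(t < T) eta * realized_advantage t w)%:E <=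
   initial_KL theta0 xstar + tracking_variation eta theta0 xstar T P tau + c%:E)%E.
Proof.
have D0 w : 0 <= D 0 w by apply: initial_KL_ge0.
have V0 w : 0 <= V w by apply: sumr_ge0 => t _; rewrite le_max lexx orbT.
have c0 : 0 <= c by rewrite mulr_ge0 // mulr_ge0 // divr_ge0 // sqr_ge0.
have mD0 := measurable_KL_current T_gt0; have mV := measurable_variation.
have [intZ _] := @integral_sum_scale _ W R P T eta (fun t => @realized_advantage t)
    (fun t => integrable_realized_advantage (ltn_ord t)).
have -> : (initial_KL theta0 xstar + tracking_variation eta theta0 xstar T P tau + c%:E
    = \int[P]_w (D 0 w + V w + c)%:E)%E.
  have -> : tracking_variation eta theta0 xstar T P tau = (\int[P]_w (V w)%:E)%E.
    by rewrite /tracking_variation unlock.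
  rewrite integral_nonnegD //; last by move=> w; rewrite addr_ge0.
    rewrite integral_nonnegD // expectation_initial_KL integral_cst //=.
    by rewrite probability_setT mule1.
  exact: measurable_funD.
apply: integral_le_nonneg => //.
- by apply: measurable_funD => //; exact: measurable_funD.
- by move=> w; rewrite !addr_ge0.
- exact: sum_realized_advantage_le.
Qed.

(** The regret of a stage is half the integral of [best] minus twice the extension, the quantity
    that the expected advantage dominates. *)
Lemma regret_le_realized_advantage :
  (regret eta theta0 T P tau <=
   \int[P]_w (\sum_(t < T) 2^-1 * realized_advantage t w)%:E)%E.
Proof.
have [_ ->] := @integral_sum_scale _ W R P T 2^-1 (fun t => @realized_advantage t)
  (fun t => integrable_realized_advantage (ltn_ord t)).
apply: lee_sum => t _; rewrite unlock; have tT := ltn_ord t.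
apply: (@le_trans _ _ (2^-1%:E * \int[P]_w
    (best (@F t w) - 2 * categorical_extension (@F t w) (@probs t w))%:E)%E).
  rewrite -integral_scale; last exact: integrable_stage.
  rewrite le_eqVlt; apply/orP; left; apply/eqP; apply: eq_integral => w _.
  by rewrite /F /probs mulrBr mulrA mulVf ?mul1r ?div1r.
by apply: lee_wpmul2l; [rewrite lee_fin|exact: expected_advantage].
Qed.

Lemma regret_bound :
  (regret eta theta0 T P tau <=
     ((2 * eta)^-1)%:E *
       (initial_KL theta0 xstar + tracking_variation eta theta0 xstar T P tau)
     + (eta * T%:R * (Nmax M T)%:R * B ^+ 2 / 4)%:E)%E.
Proof.
apply: le_trans regret_le_realized_advantage _.
have eta_neq0 : eta != 0 by rewrite gt_eqF.
have [intZ _] := @integral_sum_scale _ W R P T eta (fun t => @realized_advantage t)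
  (fun t => integrable_realized_advantage (ltn_ord t)).
have -> : (\int[P]_w (\sum_(t < T) 2^-1 * realized_advantage t w)%:E =
    ((2 * eta)^-1)%:E * \int[P]_w (\sum_(t < T) eta * realized_advantage t w)%:E)%E.
  rewrite -integral_scale //; apply: eq_integral => w _; congr (_%:E).
  by rewrite mulr_sumr; apply: eq_bigr => t _; field.
(* Dividing [c] by [2 * eta] turns the error [(eta * B) ^+ 2 / 2] into [eta * B ^+ 2 / 4]. *)
have -> : eta * T%:R * (Nmax M T)%:R * B ^+ 2 / 4 = (2 * eta)^-1 * c.
  by rewrite /c; field.
(* The error term is finite, so the product distributes over the sum even when the variation is
   infinite. *)
rewrite EFinM -muleDr ?fin_num_adde_defl //.
apply: lee_wpmul2l; last exact: expected_sum_realized_advantage.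
by rewrite lee_fin invr_ge0 mulr_ge0 // ltW.
Qed.

End Regret.

Theorem lemma5 (R : realType) (I : choiceType) (A O : I -> finType)
  (d : measure_display) (S : measurableType d) (M : open_mdp R A O S)
  (T : nat) (T_gt0 : (0 < T)%N)
  (theta0 : forall i : I, O i -> A i -> R) (eta : R) (eta_gt0 : 0 < eta)
  (d' : measure_display) (W : measurableType d') (P : probability W R)
  (tau : W -> trajectory M)
  (tau_law : submapl_process eta theta0 T P tau)
  (xstar : forall t, S -> ground A (active M t) -> R)
  (xstar_measurable : forall t (e : ground A (active M t)), (t < T)%N ->
     measurable_fun [set: S] (fun s => xstar t s e))
  (xstar_feasible : forall t (s : S), (t < T)%N -> feasible (xstar t s))
  (xstar_optimal : forall t (s : S) (x : ground A (active M t) -> R),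
     (t < T)%N -> feasible x ->
     categorical_extension (utility M t s) x <= categorical_extension (utility M t s) (xstar t s))
  (A_nonempty : forall t (i : active M t), (t < T)%N -> (0 < #|A (val i)|)%N)
  (utility_ge0 : forall t (s : S) (C : {set ground A (active M t)}),
     (t < T)%N -> 0 <= utility M t s C)
  (utility_normalized : forall t (s : S),
     (t < T)%N -> set_normalized (utility M t s))
  (utility_monotone : forall t (s : S), (t < T)%N -> set_monotone (utility M t s))
  (utility_submodular : forall t (s : S),
     (t < T)%N -> set_submodular (utility M t s))
  (B : R)
  (marginal_bounded : forall t (s : S) (C : {set ground A (active M t)})
     (e : ground A (active M t)),
     (t < T)%N -> e \notin C -> 0 <= marginal (utility M t s) e C <= B) :
  (regret eta theta0 T P tau <=
     ((2 * eta)^-1)%:E *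
       (initial_KL theta0 xstar + tracking_variation eta theta0 xstar T P tau)
     + (eta * T%:R * (Nmax M T)%:R * B ^+ 2 / 4)%:E)%E.
Proof.
by apply: (@regret_bound R I A O d S M T theta0 eta d' W P tau); assumption.
Qed.
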